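(* For all sufficiently large integers $s$, $$q^*(G(4s,2s,s))\le\frac{1}{4s-2}.$$
   Context: For integers $n,r,s$, the Johnson graph $G(n,r,s)$ has as vertices all vectors $v\in\{0,1\}^n$ with exactly $r$ ones; two vertices are joined by an edge if and only if their inner product equals $s$. Modularity: for a graph $G$ with $e(G)$ edges and a partition $\mathcal{A}$ of its vertex set, $q(\mathcal{A})=\sum_{A\in\mathcal{A}}\frac{e(A)}{e(G)}-\sum_{A\in\mathcal{A}}\frac{(\sum_{v\in A}\deg(v))^2}{4e(G)^2}$, where $e(A)$ is the number of edges of $G$ with both endpoints in $A$. The modularity of $G$ is $q^*(G)=\max_{\mathcal{A}}q(\mathcal{A})$, over all partitions of the vertex set. *)

(* Defs.v *)
From HB Require Import structures.
From mathcomp Require Import all_boot all_order all_algebra.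

Set Implicit Arguments.
Unset Strict Implicit.
Unset Printing Implicit Defensive.

Import Order.TTheory GRing.Theory Num.Theory.

Record sgraph := SGraph {
  vertex :> finType;
  adj : rel vertex;
  adj_sym : symmetric adj;
  adj_irr : irreflexive adj }.

Section Modularity.
Variable G : sgraph.
Implicit Types (A : {set G}) (P : {set {set G}}).

(* Edges are unordered: each is the two-element set of its endpoints. *)
Definition edges_in A : {set {set G}} :=
  [set [set x; y] | x in A, y in A & adj x y].

Definition num_edges_in A : nat := #|edges_in A|.

Definition num_edges : nat := num_edges_in [set: G].

Definition deg (v : G) : nat := #|[set w | adj v w]|.

Local Open Scope ring_scope.

(* For an edgeless graph all quotients are 0 by the convention x / 0 = 0. *)
Definition modularity_score P : rat :=
  \sum_(A in P) (num_edges_in A)%:R / num_edges%:R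
  - \sum_(A in P) ((\sum_(v in A) deg v)%N%:R ^+ 2
                   / (4%:R * num_edges%:R ^+ 2)).

Definition singletons : {set {set G}} := [set [set x] | x : G].

(* The default value of the iterated maximum is itself the score of a
   partition (see singletons_partition), so this is a genuine maximum over
   partitions, as modularity_attained and modularity_ub confirm. *)
Definition modularity : rat :=
  \big[Num.max/modularity_score singletons]_(P : {set {set G}}
      | partition P [set: G]) modularity_score P.

Lemma singletons_partition : partition singletons [set: G].
Proof.
apply/and3P; split.
- apply/eqP/setP => x; rewrite inE; apply/bigcupP; exists [set x].
    exact: imset_f.
  by rewrite inE.
- apply/trivIsetP => _ _ /imsetP[x _ ->] /imsetP[y _ ->] neq.
  rewrite -setI_eq0; apply/eqP/setP => z; rewrite !inE.
  by apply/negP => /andP[/eqP-> /eqP exy]; rewrite exy eqxx in neq.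
- by apply/imsetP => -[x _ /setP/(_ x)]; rewrite !inE eqxx.
Qed.

Lemma modularity_ub P :
  partition P [set: G] -> modularity_score P <= modularity.
Proof. by move=> partP; rewrite /modularity (bigD1 P) //= le_max lexx. Qed.

Lemma modularity_attained :
  exists2 P, partition P [set: G] & modularity = modularity_score P.
Proof.
rewrite /modularity; elim/big_ind: _ => [|x y [P pP ->] [Q pQ ->]|P pP].
- by exists singletons => //; exact: singletons_partition.
- by case: leP => _; [exists Q | exists P].
- by exists P.
Qed.

End Modularity.

Section Johnson.
Variables n r s : nat.

Definition johnson_vertex : finType :=
  {v : {ffun 'I_n -> bool} | \sum_(i < n) v i == r}.

Definition inner (v w : {ffun 'I_n -> bool}) : nat :=
  \sum_(i < n) v i * w i.

(* Distinctness only matters when s = r, where it rules out loops. *)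
Definition johnson_adj (v w : johnson_vertex) : bool :=
  (v != w) && (inner (val v) (val w) == s).

Lemma johnson_adj_sym : symmetric johnson_adj.
Proof.
move=> v w; rewrite /johnson_adj eq_sym; congr (_ && (_ == _)).
by apply: eq_bigr => i _; rewrite mulnC.
Qed.

Lemma johnson_adj_irr : irreflexive johnson_adj.
Proof. by move=> v; rewrite /johnson_adj eqxx. Qed.

Definition johnson : sgraph := SGraph johnson_adj_sym johnson_adj_irr.

End Johnson.

(* Main.v *)
Require Import Defs.
From mathcomp Require Import all_boot all_order all_algebra.
From mathcomp Require Import zify ring lra.

(* For a set I of i disjoint pairs of coordinates put
   f_I (v) = \prod_((x, y) in I) (v_x - v_y).  Each f_I is an eigenvector of the
   adjacency matrix of G(4s, 2s, s), with eigenvalue the coefficient E_i of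
   X^s Y^s in ((1 + X)(1 + Y))^(2s - i) (X - Y)^i, that is
   \sum_h (-1)^h C(i, h) C(2s - i, s - h)^2, and the f_I span all functions.
   E_i vanishes for odd i, and for even i it satisfies
   (4s - i)(2s - i - 1) E_(i+2) = - (i + 1)(2s - i) E_i, so that
   |E_i| <= max(|E_2|, |E_(2s)|) <= E_0 / (4s - 2) for i > 0.  The spectral
   bound on the modularity of a regular graph concludes. *)

Set Implicit Arguments.
Unset Strict Implicit.
Unset Printing Implicit Defensive.

Import Order.TTheory GRing.Theory Num.Theory.
Local Open Scope ring_scope.

(** * The eigenvalues *)

(* Extending 1/k! by 0 to negative k makes [rfact_pred] and [bin_rfact] hold without
   side conditions, hence sums of binomials have no boundary terms. *)
Definition rfact (k : int) : rat := if k is Posz n then (n`!)%:R^-1 else 0.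

Lemma rfact_pred (k : int) : rfact (k - 1) = k%:~R * rfact k.
Proof.
case: k => [[|n]|n]; first by rewrite mul0r.
- have -> : (n.+1%:Z - 1 = n%:Z)%R by lia.
  rewrite /= factS natrM invfM mulrA divff ?mul1r //.
  by rewrite pnatr_eq0.
- have -> : (Negz n - 1 = Negz n.+1)%R by lia.
  by rewrite /= mulr0.
Qed.

Lemma bin_rfact (m k : nat) :
  'C(m, k)%:R = m`!%:R * rfact k%:Z * rfact (m%:Z - k%:Z) :> rat.
Proof.
case: (leqP k m) => [le_km|lt_mk].
- have -> : (m%:Z - k%:Z = (m - k)%N%:Z)%R by lia.
  rewrite /= -(bin_fact le_km) !natrM.
  have : k`!%:R != 0 :> rat by rewrite pnatr_eq0 -lt0n fact_gt0.
  have : (m - k)`!%:R != 0 :> rat by rewrite pnatr_eq0 -lt0n fact_gt0.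
  move=> ? ?; field; exact/andP.
- have [n ->] : exists n, (m%:Z - k%:Z = Negz n)%R by exists (k - m).-1; lia.
  by rewrite bin_small //= mulr0.
Qed.

(** For i <= 2s this is C(i, h) C(2s - i, s - h)^2 without the factor i! ((2s - i)!)^2, which does
    not depend on h and which [eig] restores. *)
Definition wterm (s i : nat) (h : int) : rat :=
  rfact h * rfact (i%:Z - h) * (rfact (s%:Z - h) * rfact (s%:Z - i%:Z + h)) ^+ 2.

Definition wsum (s i : nat) : rat := \sum_(0 <= h < i.+1) (-1) ^+ h * wterm s i h%:Z.

(* Creative telescoping; [p] is the polynomial part of Zeilberger's certificate. *)
Lemma wsum_rec (s i : nat) :
  (4 * s%:R - i%:R) * (i%:R + 2) * wsum s i.+2
  + (2 * s%:R - i%:R) ^+ 3 * (2 * s%:R - i%:R - 1) * wsum s i = 0.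
Proof.
(* The two added terms vanish, and both sums of the recurrence get the same range. *)
have -> : wsum s i = \sum_(0 <= h < i.+3) (-1) ^+ h * wterm s i h%:Z.
  rewrite [RHS]big_nat_recr // [X in _ = X + _]big_nat_recr //=.
  rewrite /wterm.
  have -> : (i%:Z - i.+1%:Z = Negz 0)%R by lia.
  have -> : (i%:Z - i.+2%:Z = Negz 1)%R by lia.
  by rewrite /= !(mulr0, mul0r) !addr0.
pose S : rat := s%:R; pose I : rat := i%:R.
pose p (H : rat) : rat := - (I + 2) * H ^+ 2 - (I + 2) * (4 * S - 3 * (I + 1)) * H
   + (- 4 * S ^+ 3 + (I - 8) * S ^+ 2 + (4 * I ^+ 2 + 18 * I + 12) * S
      - (2 * I ^+ 3 + 9 * I ^+ 2 + 11 * I + 4)).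
pose G (h : nat) : rat := (-1) ^+ h * p h%:R * rfact (h%:Z - 1) * rfact (i%:Z + 2 - h%:Z)
   * (rfact (s%:Z - h%:Z) * rfact (s%:Z - i%:Z + h%:Z - 1)) ^+ 2.
transitivity (\sum_(0 <= h < i.+3) (G h.+1 - G h)); last first.
  (* Both ends vanish: [G 0] and [G i.+3] each contain [rfact] at -1. *)
  rewrite telescope_sumr // /G.
  have -> : (i%:Z + 2 - i.+3%:Z = Negz 0)%R by lia.
  by rewrite /= !(mulr0, mul0r) subrr.
rewrite !mulr_sumr -big_split /=; apply: eq_bigr => h _.
rewrite /G /wterm.
(* Every argument becomes h, i + 2 - h, s - h or s - i + h up to a shift, so that [rfact_pred]
   leaves a polynomial identity. *)
have -> : (i.+2%:Z - h%:Z = i%:Z + 2 - h%:Z)%R by lia.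
have -> : (s%:Z - i.+2%:Z + h%:Z = (s%:Z - i%:Z + h%:Z) - 1 - 1)%R by lia.
have -> : (i%:Z - h%:Z = (i%:Z + 2 - h%:Z) - 1 - 1)%R by lia.
have -> : (h.+1%:Z - 1 = h%:Z)%R by lia.
have -> : (i%:Z + 2 - h.+1%:Z = (i%:Z + 2 - h%:Z) - 1)%R by lia.
have -> : (s%:Z - h.+1%:Z = s%:Z - h%:Z - 1)%R by lia.
have -> : (s%:Z - i%:Z + h.+1%:Z - 1 = s%:Z - i%:Z + h%:Z)%R by lia.
rewrite !rfact_pred -[h.+1]addn1 exprD expr1.
move: (rfact h) (rfact (i%:Z + 2 - h%:Z)) (rfact (s%:Z - h%:Z))
  (rfact (s%:Z - i%:Z + h%:Z)) ((-1) ^+ h) => b x y z e.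
rewrite natrD !(intrD, rmorphB, rmorphN) /= -!pmulrn /p -/S -/I.
ring.
Qed.

(** Replacing h by i - h preserves [wterm] and multiplies the sign by (-1)^i. *)
Lemma wsum_odd (s i : nat) : odd i -> wsum s i = 0.
Proof.
move=> odd_i; suff : wsum s i = - wsum s i by lra.
rewrite {1}/wsum big_nat_rev /= add0n -sumrN; apply: eq_big_nat => h /andP[_ lt_hi].
have le_hi : (h <= i)%N by rewrite -ltnS.
have -> : ((i.+1 - h.+1)%N%:Z = i%:Z - h%:Z)%R by lia.
rewrite subSS -signr_odd oddB // odd_i -[(-1) ^+ h]signr_odd /wterm.
have -> : (i%:Z - (i%:Z - h%:Z) = h%:Z)%R by lia.
have -> : (s%:Z - (i%:Z - h%:Z) = s%:Z - i%:Z + h%:Z)%R by lia.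
have -> : (s%:Z - i%:Z + (i%:Z - h%:Z) = s%:Z - h%:Z)%R by lia.
by case: (odd h) => /=; rewrite ?expr0 ?expr1; ring.
Qed.

Definition eig (s i : nat) : rat := i`!%:R * (2 * s - i)`!%:R ^+ 2 * wsum s i.

Lemma eig_odd (s i : nat) : odd i -> eig s i = 0.
Proof. by move=> odd_i; rewrite /eig wsum_odd // mulr0. Qed.

Lemma eig0 (s : nat) : eig s 0 = 'C(2 * s, s)%:R ^+ 2.
Proof.
rewrite /eig /wsum big_nat1 bin_rfact /wterm.
have -> : ((2 * s)%:Z - s%:Z = s%:Z)%R by lia.
rewrite expr0 !subr0 subn0 /= fact0 invr1 !mul1r; by rewrite -mulrA !exprMn -expr2 -mulrA.
Qed.

(** Only h = s survives: 1/(s - h)! vanishes for h > s, and 1/(h - s)! for h < s. *)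
Lemma eig_last (s : nat) : eig s (2 * s) = (-1) ^+ s * 'C(2 * s, s)%:R.
Proof.
rewrite /eig /wsum (@big_cat_nat _ _ _ s) //=; last lia.
rewrite big_nat big1 ?add0r; last first.
  move=> h /andP[_ lt_hs]; rewrite /wterm.
  have [n ->] : exists n, (s%:Z - (2 * s)%N%:Z + h%:Z = Negz n)%R by exists (s - h).-1; lia.
  by rewrite /= !(mulr0, expr0n).
rewrite big_ltn; last lia.
rewrite big_nat big1 ?addr0; last first.
  move=> h /andP[lt_sh _]; rewrite /wterm.
  have [n ->] : exists n, (s%:Z - h%:Z = Negz n)%R by exists (h - s).-1; lia.
  by rewrite /= !(mul0r, mulr0, expr0n).
rewrite bin_rfact /wterm subnn.
have -> : ((2 * s)%N%:Z - s%:Z = s%:Z)%R by lia.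
have -> : (s%:Z - (2 * s)%N%:Z + s%:Z = 0)%R by lia.
rewrite subrr /= fact0 invr1. move: ((2*s)`!%:R : rat) ((-1)^+s : rat) => x y; ring.
Qed.

Lemma eig_rec (s i : nat) : (i.+2 <= 2 * s)%N ->
  (4 * s%:R - i%:R) * (2 * s%:R - i%:R - 1) * eig s i.+2
  = - ((i%:R + 1) * (2 * s%:R - i%:R) * eig s i).
Proof.
move=> le_i; rewrite /eig.
have -> : (2 * s - i = (2 * s - i.+2).+2)%N by lia.
rewrite !factS !natrM.
have -> : (2 * s - i.+2).+1%:R = 2 * s%:R - i%:R - 1 :> rat.
  by rewrite -addn1 natrD natrB // natrM -addn2 natrD; ring.
have -> : (2 * s - i.+2).+2%:R = 2 * s%:R - i%:R :> rat.
  by rewrite -addn2 natrD natrB // natrM -addn2 natrD; ring.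
move: (wsum_rec s i); move: (wsum s i.+2) (wsum s i) => x y rec.
rewrite -[i.+2]addn2 -[i.+1]addn1 !natrD.
move: (i`!%:R) ((2 * s - (i + 2))`!%:R) => f g.
apply/eqP; rewrite -subr_eq0; apply/eqP.
transitivity (f * g ^+ 2 * (i%:R + 1) * (2 * s%:R - i%:R - 1) *
  ((4 * s%:R - i%:R) * (i%:R + 2) * x + (2 * s%:R - i%:R) ^+ 3 * (2 * s%:R - i%:R - 1) * y)).
  ring.
by rewrite rec mulr0.
Qed.

(** Since E_0 = C(2s, s)^2 and |E_(2s)| = C(2s, s), this gives |E_(2s)| <= E_0 / (4s - 2). *)
Lemma central_bin_lb (s : nat) : (0 < s)%N -> (4 * s - 2 <= 'C(2 * s, s))%N.
Proof.
case: s => // s _; elim: s => [|[|s] IH] //.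
have -> : (2 * s.+3 = (2 * s.+2).+2)%N by lia.
by rewrite !(binS (2 * s.+2).+1) !(binS (2 * s.+2)); lia.
Qed.

(* The ratio of consecutive terms [r b.+1 / r b] is at most 1 exactly when [low b],
   and [low] is downward closed: the sequence decreases, then increases, so it is
   bounded by its values at 1 and s. *)
Lemma eig_even_bound (s a : nat) : (0 < a <= s)%N ->
  `|eig s (2 * a)| <= 'C(2 * s, s)%:R ^+ 2 / (4 * s%:R - 2).
Proof.
move=> /andP[a_gt0 le_as].
have s_gt0 : (0 < s)%N by lia.
pose r a : rat := `|eig s (2 * a)|.
have rec b : (b < s)%N -> 
  (2 * s%:R - b%:R) * (2 * s%:R - 2 * b%:R - 1) * r b.+1 = (2 * b%:R + 1) * (s%:R - b%:R) * r b.
  move=> lt_bs; have lt_bs' : b%:R + 1 <= s%:R :> rat by rewrite natr1 ler_nat.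
  have b0 : 0 <= b%:R :> rat by [].
  have := @eig_rec s (2 * b) ltac:(lia).
  have -> : ((2 * b).+2 = 2 * b.+1)%N by lia.
  rewrite /r natrM; move: (eig _ _) (eig _ _) => x y /(congr1 Num.norm).
  rewrite normrN !normrM.
  rewrite (@ger0_norm _ (4 * _ - _)); last lra.
  rewrite (@ger0_norm _ (2 * s%:R - _ - 1)); last lra.
  rewrite (@ger0_norm _ (2 * s%:R - _)); last lra.
  rewrite (@ger0_norm _ (_ + 1)); last lra.
  lra.
have r0 : r 0 = 'C(2 * s, s)%:R ^+ 2 by rewrite /r muln0 eig0 ger0_norm // exprn_ge0.
have rs : r s = 'C(2 * s, s)%:R by rewrite /r eig_last normrM normrX normrN1 expr1n mul1r ger0_norm.
have s1 : 1 <= s%:R :> rat by rewrite ler1n.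
have d_gt0 : 0 < 4 * s%:R - 2 :> rat by lra.
have cb : 4 * s%:R - 2 <= 'C(2 * s, s)%:R :> rat.
  have := central_bin_lb s_gt0; rewrite -(ler_nat rat) natrB; last lia.
  by rewrite natrM.
(* The source of the constant: at b = 0 the recurrence reads s (4s - 2) r_1 = s r_0. *)
have r1 : r 1 = r 0 / (4 * s%:R - 2).
  have := rec 0%N s_gt0; rewrite !mulr0 => H.
  apply: (mulIf (lt0r_neq0 d_gt0)); rewrite divfK ?lt0r_neq0 //.
  by apply: (mulIf (lt0r_neq0 (ltr0Sn _ s.-1))); rewrite prednK //; lra.
have pos b : 0 <= r b by exact: normr_ge0.
(* With t = s - b, the comparison (2b + 1)(s - b) <= (2s - b)(2s - 2b - 1) of the coefficients in
   [rec] becomes s + 2t <= 4t^2. *)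
pose low b := (s%:R + 2 * (s%:R - b%:R) <= 4 * (s%:R - b%:R) ^+ 2 :> rat).
have dec b : (b < s)%N -> low b -> r b.+1 <= r b.
  move=> lt_bs; rewrite /low => lowb; have := rec b lt_bs; have := pos b.
  have lt_bs' : b%:R + 1 <= s%:R :> rat by rewrite natr1 ler_nat.
  have b0 : 0 <= b%:R :> rat by [].
  move: (b%:R) (s%:R) (r b) (r b.+1) lt_bs' b0 lowb s1 => B S x y h1 h2 h3 h4 h5 h6.
  rewrite -(ler_pM2l (_ : 0 < (2 * S - B) * (2 * S - 2 * B - 1))); last by nra.
  by rewrite h6 ler_wpM2r //; nra.
have inc b : (b < s)%N -> ~~ low b -> r b <= r b.+1.
  move=> lt_bs; rewrite /low -ltNge => lowb; have := rec b lt_bs; have := pos b.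
  have lt_bs' : b%:R + 1 <= s%:R :> rat by rewrite natr1 ler_nat.
  have b0 : 0 <= b%:R :> rat by [].
  move: (b%:R) (s%:R) (r b) (r b.+1) lt_bs' b0 lowb s1 => B S x y h1 h2 h3 h4 h5 h6.
  rewrite -(ler_pM2l (_ : 0 < (2 * S - B) * (2 * S - 2 * B - 1))); last by nra.
  by rewrite h6 ler_wpM2r //; nra.
have low_pred b : (b.+1 < s)%N -> low b.+1 -> low b.
  move=> lt_bs; rewrite /low -[b.+1%:R]natr1.
  have : b%:R + 2 <= s%:R :> rat by rewrite -natrD ler_nat; lia.
  move: (b%:R) (s%:R) s1 => B S h1 h2 h3; nra.
rewrite -/(r a); apply: (@le_trans _ _ (Num.max (r 1) (r s))); last first.
  rewrite ge_max r1 r0 lexx /= rs ler_pdivlMr // expr2.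
  by apply: ler_wpM2l.
(* If [low] holds at a - 1, it holds below, and r decreases from 1 to a. Otherwise it fails from a -
   1 to s - 1, and r increases from a to s. *)
rewrite le_max; case: (boolP (low a.-1)) => [lowa | hia].
  have {}lowa b : (b < a)%N -> low b.
    move: lowa; case: a a_gt0 le_as => //= a _ le_as lowa le_ba.
    have [k Ek] : exists k, a = (b + k)%N by exists (a - b)%N; lia.
    move: lowa; rewrite {}Ek in le_as *; elim: k le_as => [|k IH]; first by rewrite addn0.
    rewrite addnS => le_as lowk; apply: IH; first lia.
    by apply: low_pred => //; lia.
  apply/orP; left; elim: a a_gt0 le_as lowa => // -[|a] IH _ le_as lowa //.
  apply: le_trans (dec _ _ _) (IH _ _ _) => //; first exact: lowa; first lia.
  by move=> b lt_ba; apply: lowa; lia.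
have {}hia b : (a.-1 <= b < s)%N -> ~~ low b.
  move=> /andP[le_ab lt_bs].
  have [k Ek] : exists k, b = (a.-1 + k)%N by exists (b - a.-1)%N; lia.
  rewrite {}Ek {le_ab} in lt_bs *; elim: k lt_bs => [|k IH]; first by rewrite addn0.
  rewrite addnS => lt_bs; apply: contra (IH _); last lia.
  exact: low_pred.
apply/orP; right.
have [k Ek] : exists k, s = (a + k)%N by exists (s - a)%N; lia.
have : (a + k <= s)%N by rewrite Ek.
rewrite [in r s]Ek; elim: k {Ek} => [|k IH] le_k; first by rewrite addn0.
apply: le_trans (IH _) _; first lia.
by rewrite addnS; apply: inc; first lia; apply: hia; lia.
Qed.

Lemma eig_bound (s i : nat) : (0 < i <= 2 * s)%N ->
  eig s i <= eig s 0 / (4 * s%:R - 2).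
Proof.
move=> /andP[i_gt0 le_i].
have d_gt0 : 0 < 4 * s%:R - 2 :> rat.
  have : 1 <= s%:R :> rat by rewrite ler1n; lia.
  lra.
case: (boolP (odd i)) => [/eig_odd-> | even_i].
  by rewrite eig0 divr_ge0 ?exprn_ge0 // ltW.
have -> : i = (2 * i./2)%N by lia.
rewrite eig0; apply: le_trans (ler_norm _) (eig_even_bound _); lia.
Qed.

(** * Generating polynomials of the eigenvalues *)

Definition points (T : Type) (I : seq (T * T)) : seq T :=
  flatten [seq [:: p.1; p.2] | p <- I].

Lemma size_points (T : Type) (I : seq (T * T)) : size (points I) = (2 * size I)%N.
Proof. by elim: I => //= p I IH; rewrite /points /= -/(points I) IH; lia. Qed.

(** [uniq (points I)] says that the pairs are disjoint with distinct entries, so the sum over the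
    cube factors: a pair (x, y) contributes the sum of F_x(a) F_y(b) (a - b) over bits a, b, and
    each other coordinate its total weight. *)
Lemma sum_ffun_bool_pairs (R : comNzRingType) (T : finType)
    (F : T -> bool -> R) (I : seq (T * T)) : uniq (points I) ->
  \sum_(w : {ffun T -> bool}) (\prod_z F z (w z)) * \prod_(p <- I) ((w p.1)%:R - (w p.2)%:R)
  = \prod_(p <- I) (F p.1 true * F p.2 false - F p.1 false * F p.2 true)
    * \prod_(z | z \notin points I) (F z true + F z false).
Proof.
elim: I F => [|[x y] I IH] F.
  move=> _; rewrite big_nil mul1r.
  transitivity (\sum_(w : {ffun T -> bool}) \prod_z F z (w z)).
    by apply: eq_bigr => w _; rewrite big_nil mulr1.
  rewrite -(bigA_distr_bigA F); apply: eq_big => [z|z _]; first by rewrite in_nil.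
  by rewrite big_bool.
rewrite /points /= -/(points I) inE negb_or -andbA => /and4P[neq_xy xI yI uI].
(* Setting the weight of [false] at u to 0 absorbs a factor w_u into the weights, which allows
   induction on I. *)
pose F' u z b := if (z == u) && ~~ b then 0 else F z b.
have F'E u (w : {ffun T -> bool}) : \prod_z F' u z (w z) = (w u)%:R * \prod_z F z (w z).
  rewrite (bigD1 u) //= [X in _ = _ * X](bigD1 u) //= /F' eqxx /=.
  case: (w u); rewrite ?mul0r ?mul1r //=; congr (_ * _).
  by apply: eq_bigr => z /negPf->.
transitivity (\sum_(w : {ffun T -> bool})
    (\prod_z F' x z (w z)) * \prod_(p <- I) ((w p.1)%:R - (w p.2)%:R)
  - \sum_(w : {ffun T -> bool})
    (\prod_z F' y z (w z)) * \prod_(p <- I) ((w p.1)%:R - (w p.2)%:R)).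
  by rewrite -sumrB; apply: eq_bigr => w _; rewrite !F'E big_cons /=; ring.
rewrite !IH // big_cons /=.
have F'I u : u \notin points I ->
   \prod_(p <- I) (F' u p.1 true * F' u p.2 false - F' u p.1 false * F' u p.2 true)
   = \prod_(p <- I) (F p.1 true * F p.2 false - F p.1 false * F p.2 true).
  move=> uI'; apply: eq_big_seq => p pI; rewrite /F'.
  have -> : (p.1 == u) = false.
    apply: contraNF uI' => /eqP<-; apply/flatten_mapP; exists p => //; exact: mem_head.
  have -> : (p.2 == u) = false.
    apply: contraNF uI' => /eqP<-; apply/flatten_mapP; exists p => //=.
    by rewrite !inE eqxx orbT.
  by [].
rewrite !F'I // -mulrBr -!mulrA [RHS]mulrCA; congr (_ * _).
have split (g : T -> R) : \prod_(z | z \notin points I) g z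
   = g x * (g y * \prod_(z | z \notin [:: x, y & points I]) g z).
  rewrite (bigD1 x) //= (bigD1 y) /=; last by rewrite yI eq_sym.
  do 2 congr (_ * _); apply: eq_bigl => z; rewrite !inE !negb_or.
  by case: (z == x); case: (z == y); rewrite ?andbT ?andbF.
rewrite !split.
have out u : u \in [:: x; y] ->
   \prod_(z | z \notin [:: x, y & points I]) (F' u z true + F' u z false)
   = \prod_(z | z \notin [:: x, y & points I]) (F z true + F z false).
  move=> ux; apply: eq_bigr => z; rewrite /F' => zI.
  suff -> : (z == u) = false by [].
  apply: contraNF zI => /eqP->; move: ux; rewrite !inE.
  by case/orP => ->; rewrite ?orbT.
rewrite !out ?inE ?eqxx ?orbT // /F' !eqxx /= (negPf neq_xy) eq_sym (negPf neq_xy) /=.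
ring.
Qed.

Lemma coef_XD1n (R : comNzRingType) (m j : nat) : (('X + 1 : {poly R}) ^+ m)`_j = 'C(m, j)%:R.
Proof.
elim: m j => [|m IH] j; first by rewrite expr0 coef1 bin0n; case: j.
rewrite exprS mulrDl mul1r coefD coefXM !IH.
by case: j => [|j] /=; rewrite ?bin0 ?add0r // binS natrD addrC.
Qed.

Lemma coef_XD1n_Xn (R : comNzRingType) (m k s : nat) :
  (('X + 1 : {poly R}) ^+ m * 'X^k)`_s = if (s < k)%N then 0 else 'C(m, s - k)%:R.
Proof. by rewrite coefMXn coef_XD1n. Qed.

(** The outer variable ['X] plays the role of X, the inner one ['X%:P] that of Y. *)
Definition gen_poly (m i : nat) : {poly {poly rat}} :=
  ((('X + 1) * ('X%:P + 1)) ^+ m * ('X - 'X%:P) ^+ i).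

Lemma coef_gen_poly (s i : nat) : (i <= 2 * s)%N ->
  (gen_poly (2 * s - i) i)`_s`_s = eig s i.
Proof.
move=> le_i; pose m := (2 * s - i)%N.
(* As m - (s - k) = s - i + k, exchanging k = h and k = i - h swaps the two reciprocal factorials.
   The coefficients in X and in Y thus agree, whence the square in [wterm]. *)
have binE k : (if (s < k)%N then 0 else 'C(m, s - k)%:R : rat)
    = m`!%:R * rfact (s%:Z - k%:Z) * rfact (s%:Z - i%:Z + k%:Z).
  case: ltnP => [lt_sk | le_ks].
    have [n ->] : exists n, (s%:Z - k%:Z = Negz n)%R by exists (k - s).-1; lia.
    by rewrite /= mulr0 mul0r.
  have -> : (s%:Z - k%:Z = (s - k)%N%:Z)%R by lia.
  rewrite bin_rfact; congr (_ * rfact _); rewrite /m; lia.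
rewrite /gen_poly /eig /wsum exprBn mulr_sumr coef_sum coef_sum big_mkord mulr_sumr.
apply: eq_bigr => -[h /= lt_hi] _; have le_hi : (h <= i)%N by [].
have -> : (('X + 1) * ('X%:P + 1)) ^+ m * ((-1) ^+ h * 'X^(i - h) * 'X%:P ^+ h *+ 'C(i, h))
  = ((-1) ^+ h *+ 'C(i, h))%:P%:P * (('X + 1) ^+ m * 'X^(i - h)
     * (('X + 1) ^+ m * 'X^h)%:P) :> {poly {poly rat}}.
  rewrite !(rmorphM, rmorphMn, rmorphXn, rmorphN, rmorphD, rmorph1) /=.
  rewrite exprMn mulrnAr [RHS]mulrnAl; congr (_ *+ _); ring.
rewrite coefCM coefCM coefMC coef_XD1n_Xn.
have -> : (if (s < i - h)%N then 0 else 'C(m, s - (i - h))%:R : {poly rat})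
  = (if (s < i - h)%N then 0 else 'C(m, s - (i - h))%:R)%:P.
  by case: ifP; rewrite ?rmorph0 // rmorph_nat.
rewrite coefCM coef_XD1n_Xn !binE /wterm.
have -> : ((i - h)%N%:Z = i%:Z - h%:Z)%R by lia.
have -> : (s%:Z - (i%:Z - h%:Z) = s%:Z - i%:Z + h%:Z)%R by lia.
have -> : (s%:Z - i%:Z + (i%:Z - h%:Z) = s%:Z - h%:Z)%R by lia.
rewrite -mulr_natr bin_rfact.
move: (rfact _) (rfact _) (rfact _) (rfact _) ((-1) ^+ h) (m`!%:R) (i`!%:R) => a b c d e f g.
ring.
Qed.

(** * The eigenvectors *)

Definition swap_prod (T : finType) (I : seq (T * T)) (w : {ffun T -> bool}) : rat :=
  \prod_(p <- I) ((w p.1)%:R - (w p.2)%:R).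

Lemma swap_prod_neq0 (T : finType) (I : seq (T * T)) (w : {ffun T -> bool}) :
  (swap_prod I w != 0) = all (fun p => w p.1 != w p.2) I.
Proof.
rewrite /swap_prod; elim: I => [|p I IH]; first by rewrite big_nil oner_eq0.
by rewrite big_cons mulf_eq0 negb_or IH /=; case: (w p.1); case: (w p.2).
Qed.

Lemma prod_points (R : comNzRingType) (T : Type) (I : seq (T * T)) (g : T -> R) :
  \prod_(z <- points I) g z = \prod_(p <- I) (g p.1 * g p.2).
Proof.
elim: I => [|p I IH]; first by rewrite !big_nil.
by rewrite /points /= !big_cons -/(points I) IH mulrA.
Qed.

Lemma sum_nat_if_card (T : finType) (P : pred T) : (\sum_z P z = #|P|)%N.
Proof.
rewrite -sum1_card [RHS]big_mkcond /=; apply: eq_bigr => z _.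
by rewrite unfold_in; case: (P z).
Qed.

Section Johnson.
Variable s : nat.
Hypothesis s_gt0 : (0 < s)%N.
Local Notation n := (4 * s)%N.
Local Notation J := (johnson (4 * s) (2 * s) s).

Lemma sum_johnson_vertex (v : J) : (\sum_i val v i = 2 * s)%N.
Proof. exact: eqP (valP v). Qed.

Lemma card_ones (v : J) : #|[pred z | val v z]| = (2 * s)%N.
Proof. by rewrite -sum_nat_if_card sum_johnson_vertex. Qed.

Lemma card_zeros (v : J) : #|[pred z | ~~ val v z]| = (2 * s)%N.
Proof.
have := cardC [pred z | val v z]; rewrite card_ones card_ord.
have -> : #|[predC [pred z | val v z]]| = #|[pred z | ~~ val v z]| by apply: eq_card.
lia.
Qed.

Definition meet_count (v : J) (w : {ffun 'I_n -> bool}) := (\sum_i val v i * w i)%N.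
Definition diff_count (v : J) (w : {ffun 'I_n -> bool}) := (\sum_i ~~ val v i * w i)%N.

(** As w has 2s ones, s of them lie in v exactly when s lie outside; the latter also forces w != v,
    because s > 0. *)
Lemma adjE (v w : J) :
  adj v w = (meet_count v (val w) == s) && (diff_count v (val w) == s).
Proof.
rewrite /= /johnson_adj /inner -/(meet_count v (val w)).
have tot : (meet_count v (val w) + diff_count v (val w) = 2 * s)%N.
  rewrite -[RHS](sum_johnson_vertex w) -big_split /=; apply: eq_bigr => i _.
  by case: (val v i) => //=; lia.
case: (v =P w) tot => [-> _ | _ tot] /=; last first.
  rewrite (_ : (diff_count v (val w) == s) = (meet_count v (val w) == s)) ?andbb //.
  by apply/eqP/eqP; lia.
have -> : (diff_count w (val w)) = 0%N.
  by rewrite /diff_count big1 // => i _; case: (val w i).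
by rewrite andbC [0%N == s]eq_sym gtn_eqF.
Qed.

(** The two counts force w to have 2s ones, so the sum may run over the whole cube, where it can be
    factored by coordinates. *)
Lemma sum_johnson (g : {ffun 'I_n -> bool} -> rat) (v : J) :
  \sum_(w : J) (adj v w)%:R * g (val w)
  = \sum_(w : {ffun 'I_n -> bool})
      ((meet_count v w == s) && (diff_count v w == s))%:R * g w.
Proof.
pose P (w : {ffun 'I_n -> bool}) := (\sum_(i < n) w i == 2 * s)%N.
rewrite [RHS](bigID P) /= [X in _ + X]big1 ?addr0; last first.
  move=> w; rewrite /P => neq.
  suff -> : (meet_count v w == s) && (diff_count v w == s) = false by rewrite mul0r.
  apply: contraNF neq => /andP[/eqP m_eq /eqP d_eq].
  suff <- : (meet_count v w + diff_count v w)%N = (2 * s)%N.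
    rewrite -big_split /=; apply/eqP/eq_bigr => i _.
    by case: (val v i) => //=; lia.
  lia.
rewrite (reindex_onto val (insubd v)) /=; last by move=> w Pw; rewrite insubdK.
apply: eq_big => [w|w _]; last by rewrite -adjE.
by rewrite valKd eqxx andbT; apply/esym/(valP w).
Qed.

Lemma size_disjoint_pairs (I : seq ('I_n * 'I_n)) : uniq (points I) -> (size I <= 2 * s)%N.
Proof.
move=> uI; have := max_card (mem (points I)).
rewrite (card_uniqP uI) size_points card_ord; move: (size I) => i; lia.
Qed.

(** Mark the ones of w inside v by X and those outside by Y: adjacency selects the coefficient of
    X^s Y^s. By [sum_ffun_bool_pairs], a pair (x, y) gives (v_x - v_y)(X - Y), and a free coordinate
    gives X + 1 or Y + 1. *)
Lemma swap_prod_eigen (I : seq ('I_n * 'I_n)) (v : J) : uniq (points I) ->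
  \sum_(w : J) (adj v w)%:R * swap_prod I (val w) = eig s (size I) * swap_prod I (val v).
Proof.
move=> uI; rewrite sum_johnson.
pose i := size I.
have le_i : (i <= 2 * s)%N by exact: size_disjoint_pairs.
pose F (z : 'I_n) (b : bool) : {poly {poly rat}} :=
  if b then (if val v z then 'X else 'X%:P) else 1.
have FE (w : {ffun 'I_n -> bool}) : \prod_z F z (w z) = 'X^(meet_count v w) * ('X^(diff_count v w))%:P.
  rewrite rmorphXn /= /meet_count /diff_count !expr_sum -big_split /=.
  apply: eq_bigr => z _; rewrite /F.
  by case: (w z); case: (val v z); rewrite /= ?expr0 ?expr1 ?mul1r ?mulr1.
have gen := sum_ffun_bool_pairs F uI.
have rhs : \prod_(p <- I) (F p.1 true * F p.2 false - F p.1 false * F p.2 true)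
    * \prod_(z | z \notin points I) (F z true + F z false)
  = (swap_prod I (val v))%:P%:P * gen_poly (2 * s - i) i.
  have -> : \prod_(p <- I) (F p.1 true * F p.2 false - F p.1 false * F p.2 true)
    = (swap_prod I (val v))%:P%:P * ('X - 'X%:P) ^+ i.
    rewrite /swap_prod !rmorph_prod /= /i -sum1_size expr_sum -big_split /=.
    apply: eq_bigr => p _; rewrite /F expr1 !rmorphB /= !rmorph_nat.
    by case: (val v p.1); case: (val v p.2) => /=; ring.
  case: (boolP (swap_prod I (val v) == 0)) => [/eqP-> | ]; first by rewrite !rmorph0 !mul0r.
  rewrite swap_prod_neq0 => /allP split_v.
  rewrite /gen_poly -mulrA; congr (_ * _); rewrite mulrC; congr (_ * _).
  (* Instead of counting the free ones and zeros of v, multiply by Q^i: each pair split by v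
     supplies one factor Q, and the product over all coordinates is Q^(2s). *)
  pose Q : {poly {poly rat}} := ('X + 1) * ('X%:P + 1).
  have Q_neq0 : Q ^+ i != 0.
    rewrite expf_neq0 // mulf_neq0 //; first by rewrite -size_poly_eq0 size_XaddC.
    by rewrite -polyC1 -polyCD polyC_eq0 -size_poly_eq0 size_XaddC.
  apply: (mulfI Q_neq0); rewrite -exprD subnKC //.
  transitivity (\prod_z (F z true + F z false)).
    rewrite [RHS](bigID (mem (points I))) /=; congr (_ * _).
    rewrite -big_uniq // prod_points /i -sum1_size expr_sum; apply: eq_big_seq => p pI.
    have := split_v p pI; rewrite /F /Q expr1.
    by case: (val v p.1); case: (val v p.2) => //= _; rewrite mulrC.
  rewrite (bigID (fun z => val v z)) /= exprMn; congr (_ * _).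
    rewrite (eq_bigr (fun=> 'X + 1)) => [|z]; last by rewrite /F => ->.
    by rewrite prodr_const; congr (_ ^+ _); exact: card_ones.
  rewrite (eq_bigr (fun=> 'X%:P + 1)) => [|z]; last by rewrite /F => /negPf->.
  by rewrite prodr_const; congr (_ ^+ _); exact: card_zeros.
have := congr1 (fun q : {poly {poly rat}} => q`_s`_s) gen.
rewrite rhs !coefCM coef_gen_poly // mulrC => <-.
rewrite coef_sum coef_sum; apply: eq_bigr => w _.
have -> : \prod_(p <- I) ((w p.1)%:R - (w p.2)%:R) = (swap_prod I w)%:P%:P :> {poly {poly rat}}.
  by rewrite /swap_prod !rmorph_prod /=; apply: eq_bigr => p _; rewrite !rmorphB /= !rmorph_nat.
rewrite FE [in RHS]mulrC !coefCM mulrC; congr (_ * _).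
rewrite coefMC coefXn [s == _]eq_sym.
by case: (_ == s); rewrite ?mul0r ?coef0 // mul1r coefXn eq_sym.
Qed.
End Johnson.

(** * Completeness of the eigenvectors *)

Section Complete.
Variable s : nat.
Local Notation n := (4 * s)%N.
Local Notation J := (johnson (4 * s) (2 * s) s).

Lemma johnson_vertex_eq (v w : J) : (forall z, val v z -> val w z) -> w = v.
Proof.
move=> sub; apply/val_inj/ffunP => z /=.
have /subset_cardP : #|[pred z | val v z]| = #|[pred z | val w z]| by rewrite !card_ones.
have /subsetP subvw : {subset [pred z | val v z] <= [pred z | val w z]}.
  by move=> y; rewrite !inE; exact: sub.
by move=> /(_ subvw)/(_ z); rewrite !inE.
Qed.

(* Let S I T be the sum of [swap_prod I * f] over the vertices containing T.  The
   difference [S I (t :: T) - S I (u :: T)] is [S ((t, u) :: I) T], which vanishes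
   by induction on T; summing over u then makes [S I (t :: T)] proportional to
   [S I T].  In the end, with I empty and T = v, [S I T] is [f v]. *)
Lemma swap_prod_complete (f : J -> rat) :
  (forall I : seq ('I_n * 'I_n), uniq (points I) ->
     \sum_v swap_prod I (val v) * f v = 0) ->
  forall v, f v = 0.
Proof.
move=> orth v.
have key (T : seq 'I_n) I : uniq (points I ++ T) ->
    \sum_(w : J) swap_prod I (val w) * (\prod_(t <- T) (val w t)%:R) * f w = 0.
  elim: T I => [|t T IH] I uIT.
    rewrite cats0 in uIT; rewrite -[RHS](orth I uIT).
    by apply: eq_bigr => w _; rewrite big_nil mulr1.
  move: (uIT); rewrite -(cat1s t T) uniq_catCA /= => /andP[tIT uIT1].
  pose g u := \sum_(w : J) swap_prod I (val w) * (\prod_(t <- T) (val w t)%:R)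
                * (val w u)%:R * f w.
  pose U := [pred u | u \notin points I ++ T].
  have g_const u : u \in U -> g u = g t.
    rewrite inE => uU; case: (u =P t) => [-> //|/eqP neq].
    apply/eqP; rewrite eq_sym -subr_eq0; apply/eqP.
    rewrite -[RHS](IH ((t, u) :: I)); last first.
      rewrite /points /= -/(points I) -/(points I ++ T) !inE negb_or.
      by rewrite eq_sym neq tIT uU uIT1.
    by rewrite /g -sumrB; apply: eq_bigr => w _; rewrite /swap_prod big_cons /=; ring.
  have sum_U : \sum_(u in U) g u = 0.
    rewrite /g exchange_big /=.
    (* A vertex w that contains T and splits every pair of I has 2s - |I| - |T| ones in U; all other
       w contribute 0. *)
    transitivity (\sum_(w : J) ((2 * s)%:R - (size I)%:R - (size T)%:R) *
        (swap_prod I (val w) * (\prod_(t <- T) (val w t)%:R) * f w)); last first.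
      by rewrite -mulr_sumr IH // mulr0.
    apply: eq_bigr => w _.
    under eq_bigr do rewrite mulrAC.
    rewrite -mulr_sumr mulrC.
    case: (eqVneq (swap_prod I (val w)) 0) => [->|]; first by rewrite !mul0r !mulr0.
    rewrite swap_prod_neq0 => /allP split_w.
    case: (eqVneq (\prod_(t0 <- T) (val w t0)%:R) (0 : rat)) => [->|].
      by rewrite mulr0 !mul0r !mulr0.
    rewrite prodf_seq_neq0 => /allP T_w.
    congr (_ * _).
    have tot : (\sum_u val w u)%N%:R = (2 * s)%:R :> rat by rewrite sum_johnson_vertex.
    rewrite -tot natr_sum [in RHS](bigID (mem (points I ++ T))) /=.
    rewrite (eq_bigl [pred u | u \notin points I ++ T]) //=.
    rewrite -(big_uniq _ uIT1) /= big_cat /=.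
    have -> : \sum_(u <- T) (val w u)%:R = (size T)%:R :> rat.
      rewrite -sum1_size natr_sum; apply: eq_big_seq => u uT.
      by have := T_w u uT; case: (val w u).
    have -> : \sum_(u <- points I) (val w u)%:R = (size I)%:R :> rat.
      elim: I split_w {uIT uIT1 tIT g U g_const} => [|p I IHI] split_w; first by rewrite big_nil.
      rewrite /points /= -/(points I) !big_cons IHI; last first.
        by move=> q qI; apply: split_w; rewrite inE qI orbT.
      have := split_w p (mem_head _ _); rewrite -[(size I).+1]addn1 natrD.
      by case: (val w p.1); case: (val w p.2) => //= _; ring.
    by rewrite addrC addrA; ring.
  (* U contains t, so its cardinality can be cancelled. *)
  have : (#|U|%:R : rat) * g t = 0.
    rewrite -[RHS]sum_U (eq_bigr (fun=> g t)); last by move=> u; exact: g_const.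
    by rewrite sumr_const mulr_natl.
  move/eqP; rewrite mulf_eq0 pnatr_eq0 => /orP[/eqP/card0_eq/(_ t)|/eqP gt0].
    by rewrite inE tIT.
  rewrite -[RHS]gt0; apply: eq_bigr => w _; rewrite big_cons; ring.
have prod1 : \prod_(t <- enum [pred z | val v z]) (val v t)%:R = 1 :> rat.
  by rewrite big1_seq // => z /andP[_]; rewrite mem_enum inE => ->.
have := key (enum [pred z | val v z]) [::] (enum_uniq _).
rewrite (bigD1 v) //= prod1 /swap_prod big_nil !mul1r big1 ?addr0 //.
move=> w neq; rewrite (_ : \prod_(t <- enum _) _ = 0) ?mulr0 ?mul0r //.
apply/eqP; rewrite prodf_seq_eq0; apply: contraNT neq => /hasPn w_sub.
apply/eqP/johnson_vertex_eq => z vz.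
have := w_sub z; rewrite mem_enum inE => /(_ vz) /=.
by case: (val w z); rewrite // eqxx.
Qed.
End Complete.

(** * Quadratic forms with a spanning family of eigenvectors *)

(** A column of the cokernel matrix is a function orthogonal to every [phi k], hence zero; a matrix
    with zero cokernel has full row space. *)
Lemma span_of_complete (F : fieldType) (T K : finType) (phi : K -> T -> F) :
  (forall f : T -> F, (forall k, \sum_v phi k v * f v = 0) -> forall v, f v = 0) ->
  forall f : T -> F, exists c : K -> F, forall v, f v = \sum_k c k * phi k v.
Proof.
move=> complete f.
pose Phi := \matrix_(i < #|K|, j < #|T|) phi (enum_val i) (enum_val j).
pose u : 'rV_#|T| := \row_j f (enum_val j).
have coker0 : cokermx Phi = 0.
  apply/matrixP => i j; rewrite [RHS]mxE -[i]enum_valK.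
  apply: (complete (fun v => cokermx Phi (enum_rank v) j) _ (enum_val i)) => k.
  have /matrixP/(_ (enum_rank k) j) := mulmx_coker Phi.
  rewrite [LHS]mxE [RHS]mxE => ker; rewrite -[RHS]ker (reindex _ (onW_bij _ (enum_val_bij T))) /=.
  by apply: eq_bigr => t _; rewrite [Phi _ _]mxE enum_rankK enum_valK.
have /submxP[D uD] : (u <= Phi)%MS by rewrite submxE coker0 mulmx0.
exists (fun k => D 0 (enum_rank k)) => v.
move/rowP/(_ (enum_rank v)): uD; rewrite [LHS]mxE [RHS]mxE enum_rankK => ->.
rewrite [RHS](reindex _ (onW_bij _ (enum_val_bij K))) /=.
by apply: eq_bigr => t _; rewrite [Phi _ _]mxE enum_rankK enum_valK.
Qed.

Section PositiveSemidefinite.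
Variables (R : realFieldType) (T K : finType).

(** Each class of equal [mu] contributes mu times the square of its sum. Dividing by the class size
    [n k] spreads this square over the members of the class, which avoids a sum over classes. *)
Lemma sum_eq_class_ge0 (mu a : K -> R) : (forall k, 0 <= mu k) ->
  0 <= \sum_k mu k * a k * \sum_(l | mu l == mu k) a l.
Proof.
move=> mu_ge0.
pose n k : R := #|[pred l | mu l == mu k]|%:R.
pose S k := \sum_(l | mu l == mu k) a l.
suff -> : \sum_k mu k * a k * \sum_(l | mu l == mu k) a l = \sum_k mu k / n k * S k ^+ 2.
  by apply: sumr_ge0 => k _; rewrite mulr_ge0 ?sqr_ge0 // divr_ge0.
have n_neq0 k : n k != 0.
  by rewrite pnatr_eq0 -lt0n; apply/card_gt0P; exists k; rewrite inE.
transitivity (\sum_k \sum_(l | mu l == mu k) mu k / n k * S k * a l); last first.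
  by apply: eq_bigr => k _; rewrite -mulr_sumr expr2 mulrA.
rewrite (exchange_big_dep xpredT) //=; apply: eq_bigr => l _.
rewrite -/(S l) (eq_bigr (fun=> mu l / n l * S l * a l)); last first.
  move=> k /eqP mu_eq; rewrite /S /n mu_eq; congr (_ / _ * _ * _).
rewrite (eq_bigl (fun k => mu k == mu l)); last by move=> k; rewrite eq_sym.
rewrite sumr_const -[_ *+ _]mulr_natr -/(n l).
by field; exact: n_neq0.
Qed.

(** The family spans but may be dependent, and it is orthogonal only across distinct eigenvalues.
    Grouping by eigenvalue makes the form a sum over v of expressions that [sum_eq_class_ge0]
    handles one by one. *)
Lemma psd_of_eigenbasis (M : T -> T -> R) (phi : K -> T -> R) (mu : K -> R) :
  (forall v w, M v w = M w v) ->
  (forall k v, \sum_w M v w * phi k w = mu k * phi k v) ->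
  (forall f : T -> R, (forall k, \sum_v phi k v * f v = 0) -> forall v, f v = 0) ->
  (forall k, 0 <= mu k) ->
  forall f : T -> R, 0 <= \sum_v \sum_w M v w * f v * f w.
Proof.
move=> symM eigM complete mu_ge0 f.
have [c fE] := span_of_complete complete f.
have orth k l : mu k != mu l -> \sum_v phi k v * phi l v = 0.
  move=> neq; apply: (mulfI (_ : mu k - mu l != 0)); first by rewrite subr_eq0.
  rewrite mulr0 mulrBl; apply/eqP; rewrite subr_eq0 !mulr_sumr; apply/eqP.
  transitivity (\sum_v \sum_w M v w * phi k w * phi l v).
    by apply: eq_bigr => v _; rewrite -mulr_suml eigM mulrA.
  rewrite exchange_big; apply: eq_bigr => w _ /=.
  rewrite mulrCA -eigM mulr_sumr; apply: eq_bigr => v _.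
  by rewrite symM; ring.
have -> : \sum_v \sum_w M v w * f v * f w =
    \sum_v \sum_k mu k * (c k * phi k v) * \sum_(l | mu l == mu k) c l * phi l v.
  transitivity (\sum_v \sum_k mu k * (c k * phi k v) * f v).
    apply: eq_bigr => v _.
    rewrite -mulr_suml.
    transitivity (f v * \sum_w M v w * f w).
      by rewrite mulr_sumr; apply: eq_bigr => w _; ring.
    rewrite mulrC; congr (_ * _).
    transitivity (\sum_w \sum_k c k * (M v w * phi k w)).
      by apply: eq_bigr => w _; rewrite fE mulr_sumr; apply: eq_bigr => k _; ring.
    rewrite exchange_big; apply: eq_bigr => k _ /=.
    by rewrite -mulr_sumr eigM; ring.
  rewrite exchange_big [RHS]exchange_big; apply: eq_bigr => k _ /=.
  transitivity (mu k * c k * \sum_l c l * \sum_v phi k v * phi l v).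
    rewrite mulr_sumr; under [RHS]eq_bigr do rewrite !mulr_sumr.
    rewrite exchange_big; apply: eq_bigr => v _ /=.
    by rewrite fE mulr_sumr; apply: eq_bigr => l _; ring.
  rewrite (bigID (fun l => mu l == mu k)) /= [X in _ + X]big1 ?addr0; last first.
    by move=> l neq; rewrite orth ?mulr0 // eq_sym.
  transitivity (\sum_v \sum_(l | mu l == mu k) mu k * (c k * phi k v) * (c l * phi l v)).
    rewrite exchange_big /= mulr_sumr; apply: eq_bigr => l _.
    by rewrite !mulr_sumr; apply: eq_bigr => v _; ring.
  by apply: eq_bigr => v _; rewrite mulr_sumr.
by apply: sumr_ge0 => v _; exact: sum_eq_class_ge0.
Qed.
End PositiveSemidefinite.

(** * Modularity *)

(** Above each edge lie two ordered pairs, distinct because there are no loops. *)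
Lemma sum_adj_num_edges (G : sgraph) (A : {set G}) :
  (\sum_(x in A) \sum_(y in A) adj x y = 2 * num_edges_in A)%N.
Proof.
pose D := [pred p : G * G | [&& p.1 \in A, p.2 \in A & adj p.1 p.2]].
transitivity (\sum_(p in D) 1)%N.
  rewrite pair_big /= big_mkcond [RHS]big_mkcond /=; apply: eq_bigr => -[x y] _ /=.
  by rewrite inE /=; case: (x \in A); case: (y \in A) => //=; case: (adj x y).
rewrite (partition_big (fun p => [set p.1; p.2]) (mem (edges_in A))) /=; last first.
  move=> [x y] /and3P[/= xA yA xy]; apply/imset2P; exists x y => //.
  by rewrite inE yA.
rewrite mulnC -sum_nat_const; apply: eq_bigr => e /imset2P[x y xA].
rewrite inE => /andP[yA xy] ->.
have neq_xy : x != y by apply: contraTneq xy => ->; rewrite adj_irr.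
rewrite sum1_card.
have <- : #|[set (x, y); (y, x)]| = 2%N.
  by rewrite cards2 xpair_eqE negb_and neq_xy.
apply: eq_card => -[a b]; rewrite !inE !xpair_eqE.
rewrite -[LHS]/(((a, b) \in D) && ([set a; b] == [set x; y])) inE /=.
apply/andP/idP => [[/and3P[aA bA ab] /eqP eq_set]|].
  have neq_ab : a != b by apply: contraTneq ab => ->; rewrite adj_irr.
  have : a \in [set x; y] by rewrite -eq_set !inE eqxx.
  have : b \in [set x; y] by rewrite -eq_set !inE eqxx orbT.
  rewrite !inE => /orP[]/eqP eb /orP[]/eqP ea; move: neq_ab; rewrite ea eb ?eqxx //.
  by rewrite orbT.
case/orP => /andP[/eqP-> /eqP->]; first by rewrite xA yA xy.
by rewrite xA yA adj_sym xy setUC.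
Qed.

(** * The spectral bound for the Johnson graph *)

Section Johnson.
Variable s : nat.
Hypothesis s_gt0 : (0 < s)%N.
Local Notation n := (4 * s)%N.
Local Notation J := (johnson (4 * s) (2 * s) s).
Local Notation d := (eig s 0).
Local Notation lam := (eig s 0 / (4 * s%:R - 2)).

Lemma deg_eig (v : J) : (deg v)%:R = d :> rat.
Proof.
have := @swap_prod_eigen s s_gt0 [::] v isT.
rewrite /swap_prod big_nil mulr1 => <-; rewrite /deg -sum1_card natr_sum big_mkcond /=.
by apply: eq_bigr => w _; rewrite big_nil mulr1 inE; case: (johnson_adj s v w).
Qed.

Lemma eig0_gt0 : 0 < d.
Proof. by rewrite eig0 exprn_gt0 // ltr0n bin_gt0; lia. Qed.

Lemma gap_den_ge2 : 2 <= 4 * s%:R - 2 :> rat.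
Proof. have : 1 <= s%:R :> rat by rewrite ler1n. lra. Qed.

Lemma card_johnson_gt0 (v : J) : 0 < #|J|%:R :> rat.
Proof. by rewrite ltr0n; apply/card_gt0P; exists v. Qed.

(** Orthogonality to the constants: summing the eigenvector equation over all vertices gives d on
    one side and E_i < d on the other. *)
Lemma sum_swap_prod_eq0 (I : seq ('I_n * 'I_n)) :
  uniq (points I) -> (0 < size I)%N -> \sum_(v : J) swap_prod I (val v) = 0.
Proof.
move=> uI I_gt0.
have le_I : (0 < size I <= 2 * s)%N by rewrite I_gt0 size_disjoint_pairs.
have lt_eig : eig s (size I) < d.
  apply: le_lt_trans (eig_bound le_I) _.
  have := gap_den_ge2; have := eig0_gt0 => d0 D2.
  rewrite ltr_pdivrMr; nra.
have : d * (\sum_(v : J) swap_prod I (val v)) = eig s (size I) * \sum_(v : J) swap_prod I (val v).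
  rewrite !mulr_sumr.
  transitivity (\sum_(v : J) \sum_(w : J) (adj v w)%:R * swap_prod I (val w)).
    rewrite exchange_big; apply: eq_bigr => w _ /=.
    rewrite -mulr_suml; congr (_ * _).
    rewrite -(deg_eig w) /deg -sum1_card natr_sum big_mkcond /=.
    apply: eq_bigr => v _; rewrite inE johnson_adj_sym; by case: (johnson_adj s v w).
  by apply: eq_bigr => v _; exact: swap_prod_eigen.
move=> eq_d; apply: (mulfI (_ : d - eig s (size I) != 0)); first by rewrite subr_eq0 gt_eqF.
by rewrite mulrBl eq_d subrr mulr0.
Qed.

(** The matrix [M] of the difference has eigenvalue lam - E_i >= 0 on f_I with |I| = i > 0, and the
    coefficient [c] is chosen to give eigenvalue 0 on the constants. *)
Lemma adj_form_le (f : J -> rat) :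
  \sum_v \sum_w (adj v w)%:R * f v * f w
  <= lam * (\sum_v f v ^+ 2) + (d - lam) / #|J|%:R * (\sum_v f v) ^+ 2.
Proof.
pose c : rat := (d - lam) / #|J|%:R.
pose M (v w : J) : rat := lam * (v == w)%:R + c - (adj v w)%:R.
(* A finite index type for the f_I; lists with overlapping pairs are sent to the zero function, for
   which the eigenvector equation is trivial. *)
pose K := {i : 'I_(2 * s).+1 & i.-tuple ('I_n * 'I_n)}.
pose phi (k : K) (v : J) : rat :=
  if uniq (points (tagged k)) then swap_prod (tagged k) (val v) else 0.
pose mu (k : K) : rat := if (tag k : nat) == 0%N then 0 else lam - eig s (tag k).
rewrite -subr_ge0.
have -> : lam * (\sum_v f v ^+ 2) + c * (\sum_v f v) ^+ 2
    - \sum_v \sum_w (adj v w)%:R * f v * f w = \sum_v \sum_w M v w * f v * f w.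
  have -> : c * (\sum_v f v) ^+ 2 = \sum_v c * f v * \sum_w f w.
    by rewrite expr2 mulrA [c * _]mulr_sumr mulr_suml.
  rewrite mulr_sumr -big_split -sumrB; apply: eq_bigr => v _ /=.
  transitivity (\sum_w (lam * (v == w)%:R * f v * f w + c * f v * f w - (adj v w)%:R * f v * f w)).
    rewrite sumrB big_split /= -mulr_sumr; do 2 congr (_ + _).
    rewrite (bigD1 v) //= big1 ?addr0; last by move=> w; rewrite eq_sym => /negPf->; rewrite mulr0 !mul0r.
    by rewrite eqxx; rewrite mulr1; ring.
  by apply: eq_bigr => w _; rewrite /M; ring.
apply: (@psd_of_eigenbasis _ _ K M phi mu).
- by move=> v w; rewrite /M eq_sym adj_sym.
- case=> i t v; rewrite /phi /mu /=; move: (tval t) (size_tuple t) => I <-.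
  case: (boolP (uniq (points I))) => uI; last first.
    by rewrite mulr0 big1 // => w _; rewrite mulr0.
  transitivity (lam * swap_prod I (val v) + c * \sum_(w : J) swap_prod I (val w)
     - eig s (size I) * swap_prod I (val v)).
    rewrite -swap_prod_eigen // mulr_sumr.
    transitivity (\sum_(w : J) (lam * (v == w)%:R * swap_prod I (val w)
       + c * swap_prod I (val w) - (adj v w)%:R * swap_prod I (val w))).
      by apply: eq_bigr => w _; rewrite /M; ring.
    rewrite sumrB big_split /=; do 2 congr (_ + _).
    rewrite (bigD1 v) //= big1 ?addr0; last by move=> w; rewrite eq_sym => /negPf->; rewrite mulr0 !mul0r.
    by rewrite eqxx mulr1.
  case: eqP => [i0 | /eqP I_neq0]; last first.
    by rewrite sum_swap_prod_eq0 ?lt0n //; ring.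
  rewrite (size0nil i0) /swap_prod big_nil.
  under eq_bigr do rewrite big_nil.
  rewrite sumr_const /c; have := card_johnson_gt0 v => N_gt0.
  rewrite -mulr_natr mul1r divfK ?gt_eqF //; ring.
- move=> g orth; apply: swap_prod_complete => I uI.
  have le_I : (size I < (2 * s).+1)%N by rewrite ltnS size_disjoint_pairs.
  have := orth (@Tagged _ (Ordinal le_I) (fun i : 'I_(2 * s).+1 => i.-tuple _) (in_tuple I)).
  by rewrite /phi /= uI.
- case=> i t; rewrite /mu /=; case: eqP => [//|/eqP i_neq0].
  by rewrite subr_ge0 eig_bound // lt0n i_neq0 -ltnS ltn_ord.
Qed.

(** Apply [adj_form_le] to the indicator of a part A and divide by 2 e(G) = N d. The degree term
    |A|^2 / N^2 absorbs the quadratic part, leaving at most lam |A| / (N d); over all parts this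
    sums to lam / d = 1 / (4s - 2). *)
Lemma johnson_modularity_score_le (P : {set {set J}}) :
  partition P [set: J] -> modularity_score P <= 1 / (4%:R * s%:R - 2%:R).
Proof.
move=> partP.
have d_gt0 := eig0_gt0; have D_ge2 := gap_den_ge2.
(* On an empty vertex set the only partition is empty, with score 0; in the other case division by N
   is allowed. *)
case: (posnP #|J|) => [J0 | J_gt0].
  have -> : P = set0.
    apply/setP => A; rewrite inE; apply/negP => AP.
    have /and3P[_ _ /negP] := partP; apply.
    suff <- : A = set0 by [].
    by apply/setP => v; have := card0_eq J0 v.
  by rewrite /modularity_score !big_set0 subr0 divr_ge0 //; lra.
pose N : rat := #|J|%:R; have N_gt0 : 0 < N by rewrite ltr0n.
have two_m : 2 * (num_edges J)%:R = N * d :> rat.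
  rewrite -natrM -sum_adj_num_edges natr_sum.
  rewrite (eq_bigl predT) => [|v]; last by rewrite inE.
  rewrite (eq_bigr (fun=> d)) => [|v _]; first by rewrite sumr_const mulr_natl.
  rewrite -(deg_eig v) /deg -sum1_card big_mkcond /= [in RHS]big_mkcond /=; congr _%:R.
  by apply: eq_bigr => w _; rewrite !inE; case: (johnson_adj s v w).
have m_gt0 : 0 < (num_edges J)%:R :> rat by nra.
have term A : A \in P -> (num_edges_in A)%:R / (num_edges J)%:R
   - ((\sum_(v in A) deg v)%N%:R ^+ 2 / (4%:R * (num_edges J)%:R ^+ 2))
   <= lam / (N * d) * #|A|%:R.
  move=> _; set a : rat := #|A|%:R; set m : rat := (num_edges J)%:R in m_gt0 two_m *.
  have -> : (\sum_(v in A) deg v)%N%:R = a * d.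
    rewrite natr_sum (eq_bigr (fun=> d)) => [|v _]; last exact: deg_eig.
    by rewrite sumr_const mulr_natl.
  have sq_le : 2 * (num_edges_in A)%:R <= lam * a + (d - lam) / N * a ^+ 2.
    pose f (v : J) : rat := (v \in A)%:R.
    have sum_f : \sum_v f v = a.
      by rewrite /a -sum1_card natr_sum [RHS]big_mkcond; apply: eq_bigr => v _; rewrite /f; case: (v \in A).
    have sum_f2 : \sum_v f v ^+ 2 = a.
      by rewrite -sum_f; apply: eq_bigr => v _; rewrite /f; case: (v \in A); rewrite ?expr1n ?expr0n.
    have := adj_form_le f; rewrite sum_f sum_f2 -/N; apply: le_trans.
    rewrite -natrM -sum_adj_num_edges natr_sum big_mkcond; apply: ler_sum => v _ /=.
    rewrite /f; case: (v \in A); last by rewrite sumr_ge0 // => w _; rewrite mulr0 mul0r.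
    rewrite natr_sum big_mkcond; apply: ler_sum => w _ /=.
    by rewrite /f mulr1; case: (w \in A); rewrite ?mulr1 ?mulr0.
  have m_eq : m = N * d / 2 by lra.
  have lam_ge0 : 0 <= lam by rewrite divr_ge0 //; lra.
  have Nd_gt0 : 0 < N * d by rewrite mulr_gt0.
  rewrite m_eq; move: (num_edges_in A)%:R sq_le => e sq_le.
  apply: (@le_trans _ _ ((lam * a + (d - lam) / N * a ^+ 2) / (N * d) - a ^+ 2 / N ^+ 2)).
    have -> : e / (N * d / 2) = 2 * e / (N * d) by field; rewrite !gt_eqF.
    have -> : (a * d) ^+ 2 / (4%:R * (N * d / 2) ^+ 2) = a ^+ 2 / N ^+ 2.
      by field; rewrite !gt_eqF.
    by rewrite lerD2r ler_pM2r // invr_gt0.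
  move: lam lam_ge0 => l l_ge0.
  have -> : (l * a + (d - l) / N * a ^+ 2) / (N * d) - a ^+ 2 / N ^+ 2
    = l / (N * d) * a - l * a ^+ 2 / (N ^+ 2 * d) by field; rewrite !gt_eqF.
  by rewrite gerBl; apply: divr_ge0; apply: mulr_ge0; rewrite ?sqr_ge0 ?(ltW d_gt0).
rewrite /modularity_score -sumrB; apply: le_trans (ler_sum _ term) _.
rewrite -mulr_sumr -natr_sum -(card_partition partP) cardsT -/N.
rewrite le_eqVlt; apply/orP; left; apply/eqP; field.
by rewrite !gt_eqF //; lra.
Qed.
End Johnson.

Theorem corollary3p1p3 :
  exists s0 : nat, forall s : nat, (s0 <= s)%N ->
    modularity (johnson (4 * s)%N (2 * s)%N s) <= 1 / (4%:R * s%:R - 2%:R).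
Proof.
(* The bound holds for every positive s. *)
exists 1%N => s s_gt0.
have [P partP ->] := modularity_attained (johnson (4 * s) (2 * s) s).
exact: johnson_modularity_score_le.
Qed.
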